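(* Let $d\geq 2$ be an integer, let $c^{(d)}_{k,n}$ ($k\in\mathbb{Z}$, $n\in\mathbb{Z}_{\geq 0}$) be the entries of the Catalan triangle of order $d$, and for $k\geq 1$ let $\mathbf{\underline{k}}$ denote the $k$-dimensional irreducible representation of $sl_2$. Then for every $n\geq 0$, as representations of $sl_2$, $$\mathbf{\underline{d}}^{\otimes n}\cong\bigoplus_{k>0} c^{(d)}_{k,n}\,\mathbf{\underline{k}} ,$$ where $c^{(d)}_{k,n}\,\mathbf{\underline{k}}$ denotes the direct sum of $c^{(d)}_{k,n}$ copies of $\mathbf{\underline{k}}$; that is, for $k>0$, $c^{(d)}_{k,n}$ is the multiplicity of $\mathbf{\underline{k}}$ in $\mathbf{\underline{d}}^{\otimes n}$.
   Context: $sl_2$ is the Lie algebra of traceless $2\times 2$ complex matrices, and $\mathbf{\underline{k}}$ ($k\geq 1$) is its unique (up to isomorphism) irreducible representation of dimension $k$; $\mathbf{\underline{1}}$ is the trivial representation, and the zeroth tensor power is $\mathbf{\underline{1}}$. For $d\geq 2$, the Catalan triangle of order $d$ is the family of integers $c^{(d)}_{k,n}$ ($k\in\mathbb{Z}$, $n\in\mathbb{Z}_{\geq0}$) defined by the initial condition $c^{(d)}_{-1,0}=-1$, $c_{1,0}^{(d)}=1$, $c_{i,0}^{(d)}=0$ for all $i\neq-1,1$, and the recurrence $$c_{k,n+1}^{(d)}=c_{k-(d-1),n}^{(d)}+c_{k-(d-3),n}^{(d)}+\dots+c_{k+d-3,n}^{(d)}+c_{k+d-1,n}^{(d)}$$ (a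 sum of $d$ terms, with first indices in steps of $2$). These numbers are also given by $c_{k,n}^{(d)}=b_{k-1,n}^{(d)}-b_{k+1,n}^{(d)}$, where the integers $b^{(d)}_{k,n}$ are defined by $(q^{1-d}+q^{3-d}+\dots+q^{d-3}+q^{d-1})^n=\sum_{k\in\mathbb{Z}}b_{k,n}^{(d)}q^k$. *)

(* Defs.v *)
From HB Require Import structures.
From mathcomp Require Import all_boot all_order all_algebra.
From mathcomp Require Import reals.
From mathcomp.real_closed Require Import complex mxtens.
From mathcomp Require Import ring.

Set Implicit Arguments.
Unset Strict Implicit.
Unset Printing Implicit Defensive.

Import GRing.Theory.
Local Open Scope ring_scope.

Section Sl2.
Variable F : fieldType.

Definition traceless : {pred 'M[F]_2} := [pred x | \tr x == 0].

Fact traceless_submod : submod_closed traceless.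
Proof.
split=> [|a x y]; rewrite !inE ?mxtrace0 // => /eqP hx /eqP hy.
by rewrite mxtraceD mxtraceZ hx hy mulr0 addr0.
Qed.

HB.instance Definition _ :=
  GRing.isSubmodClosed.Build F 'M[F]_2 traceless traceless_submod.

Record sl2 := Sl2 { sl2_mx :> 'M[F]_2; sl2_tr0 : sl2_mx \in traceless }.

HB.instance Definition _ := [isSub for sl2_mx].
HB.instance Definition _ := [Choice of sl2 by <:].
HB.instance Definition _ := [SubChoice_isSubLmodule of sl2 by <:].

Fact bracket_subproof (x y : sl2) : (x *m y - y *m x : 'M[F]_2) \in traceless.
Proof. by rewrite inE raddfB /= mxtrace_mulC subrr. Qed.

Definition bracket (x y : sl2) : sl2 := Sl2 (bracket_subproof x y).

(* Representations are taken on the column spaces F^m: x acts on v : 'cV_m by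
   ract x *m v. *)
Record sl2_rep := Sl2Rep {
  rdim : nat;
  ract :> {linear sl2 -> 'M[F]_rdim};
  ract_bracket : forall x y : sl2,
    ract (bracket x y) = ract x *m ract y - ract y *m ract x }.

Definition irreducible_rep (V : sl2_rep) : Prop :=
  (0 < rdim V)%N /\
  forall U : {vspace 'cV[F]_(rdim V)},
    (forall (x : sl2) (v : 'cV[F]_(rdim V)), v \in U -> V x *m v \in U) ->
    U = 0%VS \/ U = fullv.

Definition intertwines (V W : sl2_rep) (f : 'M[F]_(rdim W, rdim V)) : Prop :=
  forall x : sl2, f *m V x = W x *m f.

Definition isom_rep (V W : sl2_rep) : Prop :=
  exists (f : 'M[F]_(rdim W, rdim V)) (g : 'M[F]_(rdim V, rdim W)),
    [/\ intertwines f, f *m g = 1%:M & g *m f = 1%:M].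

Definition embeds_rep (V W : sl2_rep) : Prop :=
  exists f : 'M[F]_(rdim W, rdim V),
    intertwines f /\ injective (fun v : 'cV[F]_(rdim V) => f *m v).

Definition null_act (m : nat) (x : sl2) : 'M[F]_m := 0.

Fact null_act_linear m : linear (@null_act m).
Proof. by move=> a x y; rewrite /null_act scaler0 addr0. Qed.

HB.instance Definition _ m :=
  GRing.isLinear.Build F sl2 'M[F]_m *:%R (@null_act m) (@null_act_linear m).

Fact null_act_bracket m (x y : sl2) :
  null_act m (bracket x y)
  = null_act m x *m null_act m y - null_act m y *m null_act m x.
Proof. by rewrite /null_act mul0mx subrr. Qed.

Definition zero_rep : sl2_rep := Sl2Rep (@null_act_bracket 0).
Definition trivial_rep : sl2_rep := Sl2Rep (@null_act_bracket 1).

Section Operations.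
Variables V W : sl2_rep.

Definition dsum_act (x : sl2) : 'M[F]_(rdim V + rdim W) :=
  block_mx (V x) 0 0 (W x).

Fact dsum_act_linear : linear dsum_act.
Proof.
move=> a x y; rewrite /dsum_act !linearP scale_block_mx add_block_mx.
by rewrite !scaler0 !addr0.
Qed.

HB.instance Definition _ :=
  GRing.isLinear.Build F sl2 'M[F]_(rdim V + rdim W) *:%R dsum_act
    dsum_act_linear.

Fact dsum_act_bracket (x y : sl2) :
  dsum_act (bracket x y) = dsum_act x *m dsum_act y - dsum_act y *m dsum_act x.
Proof.
rewrite /dsum_act !ract_bracket !mulmx_block opp_block_mx add_block_mx.
by rewrite !mul0mx !mulmx0 !addr0 !add0r !oppr0.
Qed.

Definition dsum_rep : sl2_rep := Sl2Rep dsum_act_bracket.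

Definition tens_act (x : sl2) : 'M[F]_(rdim V * rdim W) :=
  V x *t 1%:M + 1%:M *t W x.

Fact tens_act_linear : linear tens_act.
Proof.
move=> a x y; by apply/matrixP=> i j; rewrite /tens_act !linearP !mxE; ring.
Qed.

HB.instance Definition _ :=
  GRing.isLinear.Build F sl2 'M[F]_(rdim V * rdim W) *:%R tens_act
    tens_act_linear.

Fact tens_act_bracket (x y : sl2) :
  tens_act (bracket x y) = tens_act x *m tens_act y - tens_act y *m tens_act x.
Proof.
have tensBl m p (A B : 'M[F]_m) (D : 'M[F]_p) : (A - B) *t D = A *t D - B *t D.
  by apply/matrixP=> i j; rewrite !mxE mulrBl.
have tensBr m p (D : 'M[F]_m) (A B : 'M[F]_p) : D *t (A - B) = D *t A - D *t B.
  by apply/matrixP=> i j; rewrite !mxE mulrBr.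
rewrite /tens_act !ract_bracket tensBl tensBr !mulmxDl !mulmxDr !tensmx_mul.
rewrite !mulmx1 !mul1mx.
by apply/matrixP=> i j; rewrite !mxE; ring.
Qed.

Definition tens_rep : sl2_rep := Sl2Rep tens_act_bracket.

End Operations.

Definition copies_rep (m : nat) (V : sl2_rep) : sl2_rep :=
  iter m (dsum_rep V) zero_rep.

Definition tpow_rep (V : sl2_rep) (n : nat) : sl2_rep :=
  iter n (tens_rep V) trivial_rep.

(* Meant for V irreducible: splitting off m copies of V leaves a complement
   that contains no copy of V. *)
Definition has_multiplicity (V W : sl2_rep) (m : nat) : Prop :=
  exists U : sl2_rep,
    isom_rep W (dsum_rep (copies_rep m V) U) /\ ~ embeds_rep V U.

End Sl2.

Fixpoint catalan_triangle (d : nat) (k : int) (n : nat) : int :=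
  if n is n'.+1 then
    \sum_(j < d) catalan_triangle d (k - (d%:Z - 1) + j%:Z *+ 2) n'
  else if k == 1 then 1 else if k == -1 then -1 else 0.

(* Main.v *)
Require Import Defs.
From mathcomp Require Import all_boot all_order all_algebra spectral.
From mathcomp Require Import reals.
From mathcomp.real_closed Require Import complex mxtens.
From HB Require Import structures.
From mathcomp Require Import zify ring.

Set Implicit Arguments.
Unset Strict Implicit.
Unset Printing Implicit Defensive.

Import GRing.Theory Num.Theory.
Local Open Scope ring_scope.

(** Why the decomposition holds.

    Over an algebraically closed field of characteristic 0, a nonzero
    representation W of sl_2 contains an eigenvector of h
    killed by e; applying f to it repeatedly spans a copy of an explicit
    model [spin_rep p] of dimension p ([exists_spin_sub]). In particular every
    irreducible representation of dimension p is isomorphic to [spin_rep p]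
    ([irreducible_isom_spin]), so the given irreducibles may be replaced by the
    models.

    Complete reducibility comes from Weyl's unitary trick rather than from the
    Casimir element. The models are normalised so that e and f are conjugate
    transposes of each other. This property passes to tensor products, and
    under it an injective intertwiner phi has the intertwining
    left inverse (phi^* phi)^-1 phi^* ([unitary_retraction]). Splitting off one
    copy of a model at a time writes the tensor power as a direct sum of
    models [spin_rep k], k running over a list s ([splits_list_rep]).

    The multiplicities are then forced by the weights, that is the eigenvalues
    of h. An isomorphism preserves the multiplicity of each weight
    ([isom_weights]). The multiplicities b of the tensor power satisfy the
    recurrence of the coefficients of (q^(1-d) + ... + q^(d-1))^n, while the
    number of k in s is b(k-1) - b(k+1), because [spin_rep j] has weight k-1 but
    not k+1 exactly when j = k, both or neither otherwise ([spin_mult_diff]).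
    The entries of the Catalan triangle are these same differences
    ([catalan_triangleE]), so they are the numbers of occurrences in s; this
    gives at once their sign, their vanishing for large k and the
    decomposition. The complement of the copies of V k contains no other copy
    by Schur's lemma, since its summands have other dimensions
    ([hom_list_rep0]). *)

Local Notation hom V W f := (@intertwines _ V W f).
Local Notation "V ~= W" := (isom_rep V W) (at level 70).
Local Notation "V (+) W" := (dsum_rep V W) (at level 50, left associativity).

(** * Isomorphisms, direct sums and tensor products *)

Section Isomorphisms.
Variable F : fieldType.
Implicit Types U V W : sl2_rep F.

Lemma hom_id V : hom V V 1%:M.
Proof. by move=> x; rewrite mul1mx mulmx1. Qed.

Lemma hom_comp U V W g f : hom V W g -> hom U V f -> hom U W (g *m f).
Proof. by move=> hg hf x; rewrite -mulmxA hf mulmxA hg mulmxA. Qed.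

Lemma hom_inv V W f g :
  hom V W f -> f *m g = 1%:M -> g *m f = 1%:M -> hom W V g.
Proof.
move=> hf fg gf x.
by rewrite -[LHS]mulmx1 -fg mulmxA -(mulmxA g) -hf mulmxA gf mul1mx.
Qed.

Lemma isom_refl V : V ~= V.
Proof. by exists 1%:M, 1%:M; split; rewrite ?mulmx1 //; apply: hom_id. Qed.

Lemma isom_sym V W : V ~= W -> W ~= V.
Proof. by move=> [f [g [hf fg gf]]]; exists g, f; split=> //; apply: hom_inv gf. Qed.

Lemma isom_trans U V W : U ~= V -> V ~= W -> U ~= W.
Proof.
move=> [f [g [hf fg gf]]] [f' [g' [hf' fg' gf']]].
exists (f' *m f), (g *m g'); split; first exact: hom_comp.
  by rewrite mulmxA -(mulmxA f') fg mulmx1.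
by rewrite mulmxA -(mulmxA g) gf' mulmx1.
Qed.

Lemma isom_rdim V W : V ~= W -> rdim V = rdim W.
Proof.
move=> [f [g [_ /mulmx1_min le1 /mulmx1_min le2]]].
by apply/eqP; rewrite eqn_leq le1 le2.
Qed.

Lemma isom_dim0 V : rdim V = 0%N -> V ~= zero_rep F.
Proof.
move=> V0; exists 0, 0; split; first by move=> x; rewrite mul0mx mulmx0.
  by apply/matrixP=> -[].
by apply/matrixP=> i; have := ltn_ord i; rewrite {2}V0.
Qed.

Lemma dsum_isom V V' W W' : V ~= V' -> W ~= W' -> V (+) W ~= V' (+) W'.
Proof.
move=> [f [g [hf fg gf]]] [f' [g' [hf' fg' gf']]].
exists (block_mx f 0 0 f'), (block_mx g 0 0 g'); split.
- by move=> x; rewrite !mulmx_block !mul0mx !mulmx0 !addr0 !add0r hf hf'.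
- by rewrite mulmx_block !mul0mx !mulmx0 !addr0 !add0r fg fg' -scalar_mx_block.
by rewrite mulmx_block !mul0mx !mulmx0 !addr0 !add0r gf gf' -scalar_mx_block.
Qed.

Lemma tensmx_1 m n : (1%:M : 'M[F]_m) *t (1%:M : 'M_n) = 1%:M.
Proof.
apply/matrixP=> k l; case: (mxtens_indexP k) => i j.
case: (mxtens_indexP l) => i' j'; rewrite tensmxE !mxE -natrM mulnb.
by rewrite (can_eq (@mxtens_indexK _ _)).
Qed.

Lemma tens_isom V V' W W' :
  V ~= V' -> W ~= W' -> tens_rep V W ~= tens_rep V' W'.
Proof.
move=> [f [g [hf fg gf]]] [f' [g' [hf' fg' gf']]].
exists (f *t f'), (g *t g'); split.
- by move=> x; rewrite mulmxDr mulmxDl !tensmx_mul !mulmx1 !mul1mx hf hf'.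
- by rewrite tensmx_mul fg fg' tensmx_1.
by rewrite tensmx_mul gf gf' tensmx_1.
Qed.

(** Since 0 + m is convertible to m, the identity matrix has the type of an
    intertwiner here. *)
Lemma dsum0l W : zero_rep F (+) W ~= W.
Proof.
exists (1%:M : 'M_(rdim W)), (1%:M : 'M_(rdim W)).
split; rewrite ?mul1mx // => x; rewrite [LHS]mul1mx [RHS]mulmx1.
apply/matrixP=> i j; rewrite /dsum_act !mxE.
case: splitP => [[]//|i' ei]; rewrite mxE; case: splitP => [[]//|j' ej].
by congr (W x _ _); apply: val_inj.
Qed.

Lemma dsumCA U V W : U (+) (V (+) W) ~= V (+) (U (+) W).
Proof.
pose sw m n p : 'M[F]_(n + (m + p), m + (n + p)) :=
  col_mx (row_mx 0 (row_mx 1%:M 0))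
    (col_mx (row_mx 1%:M 0) (row_mx 0 (row_mx 0 1%:M))).
have swK m n p : sw m n p *m sw n m p = 1%:M.
  rewrite /sw !mul_col_mx !mul_row_col !mul0mx !mul1mx.
  rewrite !add0r !addr0 !scalar_mx_block.
  by congr col_mx; rewrite -[LHS]block_mxEv block_mxEh col_mx0.
exists (sw _ _ _), (sw _ _ _); split; [move=> x | exact: swK | exact: swK].
rewrite /sw /= /dsum_act /= /dsum_act.
rewrite !mul_col_mx !mul_row_block !mul0mx !mul1mx !add0r !addr0.
rewrite !mul_row_col !mul0mx !add0r ?addr0 !mul_block_col !mul_mx_row.
by rewrite !(mul0mx, mulmx0, mulmx1, row_mx0, add0r, addr0).
Qed.

Lemma dsumC V W : V (+) W ~= W (+) V.
Proof.
pose sw m n : 'M[F]_(n + m, m + n) := block_mx 0 1%:M 1%:M 0.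
have swK m n : sw m n *m sw n m = 1%:M.
  by rewrite mulmx_block !mul0mx !mulmx0 !mulmx1 !addr0 !add0r -scalar_mx_block.
exists (sw _ _), (sw _ _); split; [move=> x | exact: swK | exact: swK].
by rewrite !mulmx_block !mul0mx !mulmx0 !mulmx1 !mul1mx !addr0 !add0r.
Qed.

Lemma dsumA U V W : (U (+) V) (+) W ~= U (+) (V (+) W).
Proof.
apply: isom_trans (dsumC _ _) _; apply: isom_trans (dsumCA _ _ _) _.
by apply: dsum_isom (isom_refl _) (dsumC _ _).
Qed.

End Isomorphisms.

(** * Direct sums indexed by lists *)

Section SumsOverLists.
Variable F : fieldType.
Implicit Types V : nat -> sl2_rep F.

Definition list_rep V (s : seq nat) : sl2_rep F :=
  \big[@dsum_rep F/zero_rep F]_(k <- s) V k.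

Lemma list_rep_isom V V' s :
  {in s, forall k, V k ~= V' k} -> list_rep V s ~= list_rep V' s.
Proof.
rewrite /list_rep; elim: s => [|k s IH] Vs; first by rewrite !big_nil; apply: isom_refl.
rewrite !big_cons; apply: dsum_isom; first exact/Vs/mem_head.
by apply: IH => j sj; apply: Vs; rewrite inE sj orbT.
Qed.

Lemma list_rep_cat V s t : list_rep V (s ++ t) ~= list_rep V s (+) list_rep V t.
Proof.
elim: s => [|k s IH] /=; rewrite /list_rep.
  by rewrite big_nil; apply/isom_sym/dsum0l.
rewrite !big_cons; apply: isom_trans (isom_sym (dsumA _ _ _)).
exact: dsum_isom (isom_refl _) IH.
Qed.

(** Commutation of two adjacent blocks generates all permutations. *)
Lemma list_rep_perm V s t : perm_eq s t -> list_rep V s ~= list_rep V t.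
Proof.
move=> st; pose P u := list_rep V s ~= list_rep V u.
have: P s by apply: isom_refl.
apply: (catCA_perm_ind (P := P)) st => s1 s2 s3 IH.
apply: isom_trans IH _.
have cat3 t1 t2 : list_rep V (t1 ++ t2 ++ s3) ~=
    list_rep V t1 (+) (list_rep V t2 (+) list_rep V s3).
  apply: isom_trans (list_rep_cat _ _ _) _.
  by apply: dsum_isom; [exact: isom_refl | exact: list_rep_cat].
apply: isom_trans (cat3 _ _) _; apply: isom_trans (isom_sym (cat3 _ _)).
exact: dsumCA.
Qed.

Lemma list_rep_nseq V m k : list_rep V (nseq m k) = copies_rep m (V k).
Proof. by elim: m => [|m IH]; rewrite /list_rep ?big_nil //= big_cons -IH. Qed.

Lemma list_rep_flatten V (m : nat -> nat) r :
  list_rep V (flatten [seq nseq (m k) k | k <- r]) ~=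
  \big[@dsum_rep F/zero_rep F]_(k <- r) copies_rep (m k) (V k).
Proof.
elim: r => [|k r IH] /=; first by rewrite /list_rep !big_nil; apply: isom_refl.
rewrite big_cons; apply: isom_trans (list_rep_cat _ _ _) _.
by rewrite list_rep_nseq; exact: dsum_isom (isom_refl _) IH.
Qed.

Lemma list_rep_group V s N : {in s, forall k, (0 < k <= N)%N} ->
  list_rep V s ~= \big[@dsum_rep F/zero_rep F]_(1 <= k < N.+1)
                    copies_rep (count_mem k s) (V k).
Proof.
move=> sN; apply: isom_trans (list_rep_flatten V (fun k => count_mem k s) _).
apply: list_rep_perm; apply/allP=> k _ /=; apply/eqP.
rewrite count_flatten -map_comp sumnE big_map /=.
under eq_bigr do rewrite /= count_nseq /=.
have [kN|kN] := boolP (k \in index_iota 1 N.+1).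
  rewrite (bigD1_seq k) ?iota_uniq //= eqxx mul1n big1 ?addn0 // => j jk.
  by rewrite (negbTE jk).
rewrite big1_seq => [|j /andP[_ jN]]; last by case: eqP kN => // <-; rewrite jN.
apply/count_memPn; apply: contra kN => /sN.
by rewrite mem_index_iota ltnS.
Qed.

(** Brings a direct sum over a list to the form required of a multiplicity:
    all the copies of one summand first. *)
Lemma list_rep_split V s k :
  list_rep V s ~= copies_rep (count_mem k s) (V k)
                  (+) list_rep V [seq j <- s | j != k].
Proof.
rewrite -list_rep_nseq; apply: isom_trans (list_rep_cat _ _ _).
apply: list_rep_perm; rewrite -size_filter.
have /all_pred1P <- : all (pred1 k) [seq j <- s | pred1 k j] by exact: filter_all.
by rewrite perm_sym; apply/permEl/(perm_filterC (pred1 k)).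
Qed.

End SumsOverLists.

(** * The generators e, f, h and representations given by them *)

Section Generators.
Variable F : fieldType.
Implicit Types V W : sl2_rep F.

Fact sl2_e_subproof : delta_mx 0 1 \in @traceless F.
Proof. by rewrite inE /mxtrace !big_ord_recl big_ord0 !mxE /= !addr0. Qed.
Fact sl2_f_subproof : delta_mx 1 0 \in @traceless F.
Proof. by rewrite inE /mxtrace !big_ord_recl big_ord0 !mxE /= !addr0. Qed.
Definition sl2_e := Sl2 sl2_e_subproof.
Definition sl2_f := Sl2 sl2_f_subproof.
(** Taking h to be the bracket, which is the diagonal matrix (1, -1), makes
    h redundant when a map is checked to be an intertwiner. *)
Definition sl2_h := bracket sl2_e sl2_f.

Lemma mx2P (A B : 'M[F]_2) :
  A 0 0 = B 0 0 -> A 0 1 = B 0 1 -> A 1 0 = B 1 0 -> A 1 1 = B 1 1 -> A = B.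
Proof.
move=> h00 h01 h10 h11; apply/matrixP=> i j.
have ord2 (k : 'I_2) : k = 0 \/ k = 1.
  by case: k => [[|[|//]] ?]; [left | right]; apply: val_inj.
by case: (ord2 i) (ord2 j) => -> [] ->.
Qed.

Lemma sl2_mx11 (x : sl2 F) : x 1 1 = - x 0 0.
Proof.
have := sl2_tr0 x; rewrite inE /mxtrace !big_ord_recl big_ord0 addr0.
rewrite addrC addr_eq0 => /eqP <-; congr (sl2_mx x _ _); exact: val_inj.
Qed.

Lemma sl2_decomp (x : sl2 F) :
  x = x 0 0 *: sl2_h + x 0 1 *: sl2_e + x 1 0 *: sl2_f.
Proof.
apply: val_inj; rewrite /= !mul_delta_mx.
by apply: mx2P; rewrite ?sl2_mx11 !mxE /=; ring.
Qed.

Lemma bracket_he : bracket sl2_h sl2_e = sl2_e *+ 2.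
Proof.
apply: val_inj; rewrite mulr2n /= !mul_delta_mx mulmxBl mulmxBr.
rewrite !mul_delta_mx_cond /= !mulr0n !mulr1n.
by apply: mx2P; rewrite !mxE /=; ring.
Qed.

Lemma bracket_hf : bracket sl2_h sl2_f = - (sl2_f *+ 2).
Proof.
apply: val_inj; rewrite mulr2n /= !mul_delta_mx mulmxBl mulmxBr.
rewrite !mul_delta_mx_cond /= !mulr0n !mulr1n.
by apply: mx2P; rewrite !mxE /=; ring.
Qed.

Lemma rep_ef V : V sl2_e *m V sl2_f = V sl2_f *m V sl2_e + V sl2_h.
Proof. by rewrite ract_bracket addrC subrK. Qed.

Lemma rep_he V : V sl2_h *m V sl2_e = V sl2_e *m V sl2_h + V sl2_e *+ 2.
Proof. have := ract_bracket V sl2_h sl2_e.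
by rewrite bracket_he raddfMn /= => ->; rewrite addrC subrK. Qed.

Lemma rep_hf V : V sl2_h *m V sl2_f = V sl2_f *m V sl2_h - V sl2_f *+ 2.
Proof. have := ract_bracket V sl2_h sl2_f.
by rewrite bracket_hf raddfN raddfMn /= => ->; rewrite addrC subrK. Qed.

(** The elements e and f generate sl_2 as a Lie algebra. *)
Lemma hom_ef V W (phi : 'M_(rdim W, rdim V)) :
  phi *m V sl2_e = W sl2_e *m phi -> phi *m V sl2_f = W sl2_f *m phi ->
  hom V W phi.
Proof.
move=> he hf x; have hh : phi *m V sl2_h = W sl2_h *m phi.
  rewrite !ract_bracket mulmxBr mulmxBl !mulmxA he hf -!mulmxA.
  by rewrite he hf.
have act (U : sl2_rep F) : U x = x 0 0 *: U sl2_h + x 0 1 *: U sl2_e + x 1 0 *: U sl2_f.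
  have UD (y z : sl2 F) : U (y + z) = U y + U z by rewrite raddfD.
  have UZ a (y : sl2 F) : U (a *: y) = a *: U y.
    by rewrite -[a *: y]addr0 linearP raddf0 addr0.
  by rewrite {1}(sl2_decomp x) !UD !UZ.
rewrite !act !mulmxDr !mulmxDl -!scalemxAr.
by rewrite -!scalemxAl he hf hh.
Qed.

(** Three matrices with the commutation relations of h, e and f determine a
    representation, by linear extension. *)
Section Triple.
Variables (m : nat) (E X H : 'M[F]_m).
Hypothesis HE : H *m E = E *m H + E *+ 2.
Hypothesis HX : H *m X = X *m H - X *+ 2.
Hypothesis EX : E *m X = X *m E + H.

Definition triple_act (x : sl2 F) : 'M[F]_m :=
  x 0 0 *: H + x 0 1 *: E + x 1 0 *: X.

Fact triple_act_linear : linear triple_act.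
Proof.
by move=> a x y; apply/matrixP=> i j; rewrite !mxE; ring.
Qed.

HB.instance Definition _ :=
  GRing.isLinear.Build F (sl2 F) 'M[F]_m *:%R triple_act triple_act_linear.

Fact triple_act_bracket (x y : sl2 F) :
  triple_act (bracket x y) =
  triple_act x *m triple_act y - triple_act y *m triple_act x.
Proof.
have one : lift ord0 ord0 = 1 :> 'I_2 by exact: val_inj.
rewrite /triple_act /= !mulmxDl !mulmxDr -!scalemxAl -!scalemxAr HE HX EX.
move: (X *m H) (E *m H) (X *m E) (H *m H) (E *m E) (X *m X) => XH EH XE H2 E2 X2.
apply/matrixP=> i j; rewrite !mxE !big_ord_recl !big_ord0 one !sl2_mx11.
ring.
Qed.

Definition triple_rep : sl2_rep F := Sl2Rep triple_act_bracket.

Lemma triple_rep_e : triple_rep sl2_e = E.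
Proof. by rewrite /= /triple_act /= !mxE /= !scale0r scale1r add0r addr0. Qed.
Lemma triple_rep_f : triple_rep sl2_f = X.
Proof. by rewrite /= /triple_act /= !mxE /= !scale0r scale1r !add0r. Qed.
Lemma triple_rep_h : triple_rep sl2_h = H.
Proof.
by rewrite ract_bracket triple_rep_e triple_rep_f EX addrC addKr.
Qed.

End Triple.

End Generators.

(** * Explicit models of the irreducible representations *)

Section SpinRep.
Variable C : numClosedFieldType.

(** The square root gives e and f the same matrix entries up to
    transposition, which the unitary trick relies on; the square is the familiar
    coefficient (i + 1) (p - 1 - i) of e on the unnormalised basis
    v, f v, f (f v), ... *)
Definition spin_coef p i : C := sqrtC (i.+1 * (p.-1 - i))%:R.
Definition spin_wt p i : int := p%:Z - 1 - i%:Z *+ 2.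

Definition raise_mx p : 'M[C]_p :=
  \matrix_(i, j) (spin_coef p i *+ (j == i.+1 :> nat)).
Definition lower_mx p : 'M[C]_p :=
  \matrix_(i, j) (spin_coef p j *+ (i == j.+1 :> nat)).
Definition weight_mx p : 'M[C]_p := diag_mx (\row_i (spin_wt p i)%:~R).

Lemma sum_ord_eq (p k : nat) (c : nat -> C) :
  \sum_(j < p) c j *+ (j == k :> nat) = if (k < p)%N then c k else 0.
Proof.
case: ltnP => kp; last first.
  by rewrite big1 // => j _; rewrite ltn_eqF ?mulr0n // (leq_trans _ kp).
rewrite (bigD1 (Ordinal kp)) //= eqxx big1 ?addr0 // => j.
by rewrite -val_eqE /= => /negbTE ->.
Qed.

Lemma spin_coef_sqr p i : spin_coef p i ^+ 2 = (i.+1 * (p.-1 - i))%:R.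
Proof. exact: sqrtCK. Qed.

Lemma spin_wtS p i : spin_wt p i = spin_wt p i.+1 + 2.
Proof. by rewrite /spin_wt; lia. Qed.

Lemma weight_raise p :
  weight_mx p *m raise_mx p = raise_mx p *m weight_mx p + raise_mx p *+ 2.
Proof.
apply/matrixP=> i j; rewrite mul_diag_mx mul_mx_diag mulr2n !mxE.
case: eqP => [->|_]; last by rewrite !mulr0n mulr0 mul0r !addr0.
by rewrite (spin_wtS p i) intrD; ring.
Qed.

Lemma weight_lower p :
  weight_mx p *m lower_mx p = lower_mx p *m weight_mx p - lower_mx p *+ 2.
Proof.
apply/matrixP=> i j; rewrite mul_diag_mx mul_mx_diag mulr2n !mxE.
case: eqP => [->|_]; last by rewrite !mulr0n mulr0 mul0r !addr0 subr0.
by rewrite (spin_wtS p j) intrD; ring.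
Qed.

(** On the i-th basis vector this is the identity
    (i + 1) (p - 1 - i) = i (p - i) + (p - 1 - 2 i). Both boundary cases are
    covered by these formulas, because (i + 1) (p - 1 - i) vanishes at i = p - 1
    and i (p - i) vanishes at i = 0. *)
Lemma raise_lower p :
  raise_mx p *m lower_mx p = lower_mx p *m raise_mx p + weight_mx p.
Proof.
apply/matrixP=> i k; rewrite !mxE.
under eq_bigr do rewrite !mxE.
under [X in _ = X + _]eq_bigr do rewrite !mxE.
have [<-|ik] := eqVneq i k; last first.
  have nik : (i == k :> nat) = false by apply/negbTE.
  rewrite mulr0n addr0 !big1 // => j _.
    case: (eqVneq (i : nat) j.+1) => [ij|_]; last by rewrite mulr0n mul0r.
    by rewrite -ij eq_sym nik mulr0n mulr0.
  case: (eqVneq (j : nat) i.+1) => [->|_]; last by rewrite mulr0n mul0r.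
  by rewrite eqSS nik mulr0n mulr0.
have sqr m (b : bool) : (spin_coef p m *+ b) * (spin_coef p m *+ b) =
    (m.+1 * (p.-1 - m))%:R *+ b.
  by rewrite -spin_coef_sqr; case: b; rewrite ?mulr1n ?mulr0n ?mul0r.
under eq_bigr do rewrite sqr.
under [X in _ = X + _]eq_bigr do rewrite sqr.
rewrite (sum_ord_eq p i.+1 (fun=> (i.+1 * (p.-1 - i))%:R)).
have -> : \sum_(j < p) (j.+1 * (p.-1 - j))%:R *+ (i == j.+1 :> nat) =
    (i * (p - i))%:R :> C.
  case: (nat_of_ord i) (ltn_ord i) => [_|l lp].
    by rewrite big1 // => j _; rewrite mulr0n.
  under eq_bigr do rewrite eqSS eq_sym.
  rewrite (sum_ord_eq p l (fun j => (j.+1 * (p.-1 - j))%:R)) ltnW //.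
  by congr (_ * _)%:R; lia.
have -> : (if (i.+1 < p)%N then (i.+1 * (p.-1 - i))%:R else 0) =
    (i.+1 * (p.-1 - i))%:R :> C.
  case: ltnP => // pi; have -> : (p.-1 - i = 0)%N by have := ltn_ord i; lia.
  by rewrite muln0.
rewrite mulr1n !pmulrn -intrD; congr _%:~R; rewrite /spin_wt.
have := ltn_ord i; nia.
Qed.

Definition spin_rep p : sl2_rep C :=
  triple_rep (weight_raise p) (weight_lower p) (raise_lower p).

Lemma spin_rep_e p : spin_rep p (sl2_e C) = raise_mx p.
Proof. exact: triple_rep_e. Qed.
Lemma spin_rep_f p : spin_rep p (sl2_f C) = lower_mx p.
Proof. exact: triple_rep_f. Qed.
Lemma spin_rep_h p : spin_rep p (sl2_h C) = weight_mx p.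
Proof. exact: triple_rep_h. Qed.

End SpinRep.

(** * Highest weight vectors and the copies of the models they generate *)

Section HighestWeight.
Variable C : numClosedFieldType.

Lemma char_poly_col_eigen m (A : 'M[C]_m) (v : 'cV_m) a :
  v != 0 -> A *m v = a *: v -> root (char_poly A) a.
Proof.
move=> v0 Av; have <- : char_poly A^T = char_poly A.
  rewrite /char_poly -[LHS]det_tr; congr (\det _).
  by apply/matrixP=> i j; rewrite !mxE eq_sym.
rewrite -eigenvalue_root_char.
apply/eigenvalueP; exists v^T; last by rewrite trmx_eq0.
by rewrite -trmx_mul Av linearZ.
Qed.

Lemma col_eigenvector m (A : 'M[C]_m) :
  (0 < m)%N -> exists a (v : 'cV_m), v != 0 /\ A *m v = a *: v.
Proof.
move=> /(eigenvalue_closed A^T) [a /eigenvalueP[v vA v0]].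
exists a, v^T; rewrite trmx_eq0; split=> //.
by rewrite -[A]trmxK -trmx_mul vA linearZ.
Qed.

Section Shift.
Variables (m : nat) (A X : 'M[C]_m) (c : C).
Hypothesis AX : A *m X = X *m A + c *: X.

Lemma iter_shift_eigen (v : 'cV_m) a i :
  A *m v = a *: v ->
  A *m iter i (mulmx X) v = (a + c *+ i) *: iter i (mulmx X) v.
Proof.
move=> Av; elim: i => [|i IH] /=; first by rewrite mulr0n addr0.
rewrite mulmxA AX mulmxDl -mulmxA IH -scalemxAr -scalemxAl -scalerDl.
by rewrite -addrA -mulrSr.
Qed.

(** Otherwise a, a + c, a + 2 c, ... would all be eigenvalues of A, and they
    are pairwise distinct in characteristic 0. *)
Lemma iter_shift_nilp (v : 'cV_m) a :
  c != 0 -> A *m v = a *: v -> exists i, iter i (mulmx X) v == 0.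
Proof.
move=> c0 Av.
have [/existsP[i ?]|] := boolP [exists i : 'I_m.+1, iter i (mulmx X) v == 0].
  by exists i.
rewrite negb_exists => /forallP nz.
pose rs := [seq a + c *+ i | i <- iota 0 m.+1].
suff: (size rs < size (char_poly A))%N.
  by rewrite size_char_poly size_map size_iota ltnn.
apply: max_poly_roots.
- by rewrite -size_poly_gt0 size_char_poly.
- rewrite all_map; apply/allP=> i; rewrite mem_iota => /andP[_ im] /=.
  exact: char_poly_col_eigen (nz (Ordinal im)) (iter_shift_eigen _ Av).
rewrite map_inj_uniq ?iota_uniq // => i j /addrI /eqP.
by rewrite -mulr_natr -(mulr_natr c) (inj_eq (mulfI c0)) eqr_nat => /eqP.
Qed.

Lemma last_nonzero_iter (v : 'cV_m) a : c != 0 -> v != 0 -> A *m v = a *: v ->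
  exists i, iter i (mulmx X) v != 0 /\ iter i.+1 (mulmx X) v = 0.
Proof.
move=> c0 v0 Av; case: (ex_minnP (iter_shift_nilp c0 Av)) => -[|i] /eqP Xv min.
  by case/eqP: v0.
by exists i; split=> //; apply/negP => /min; rewrite ltnn.
Qed.

End Shift.

Lemma row_fullP_ker m n (A : 'M[C]_(m, n)) :
  (forall v : 'cV_n, A *m v = 0 -> v = 0) -> row_full A.
Proof.
move=> injA; rewrite -[A]trmxK /row_full mxrank_tr.
apply: inj_row_free => v vA; apply: trmx_inj; rewrite trmx0; apply: injA.
by apply: trmx_inj; rewrite trmx_mul trmxK trmx0.
Qed.

(** A highest weight vector v of weight lam whose string v, f v, f (f v), ...
    stops after p = l + 1 terms spans a copy of the p-dimensional model. *)
Section Cyclic.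
Variables (W : sl2_rep C) (v : 'cV[C]_(rdim W)) (lam : C) (l : nat).
Local Notation E := (W (sl2_e C)).
Local Notation X := (W (sl2_f C)).
Local Notation H := (W (sl2_h C)).
Local Notation u i := (iter i (mulmx X) v).
Hypotheses (Ev : E *m v = 0) (Hv : H *m v = lam *: v).
Hypotheses (ul : u l != 0) (ulS : u l.+1 = 0).
Local Notation p := l.+1.

Lemma act_f_string i : H *m u i = (lam - 2 *+ i) *: u i.
Proof.
rewrite (@iter_shift_eigen _ H X (-2) _ _ lam) ?mulNrn //.
by rewrite scaleNr scaler_nat -rep_hf.
Qed.

Lemma act_e_string i : E *m u i.+1 = ((lam - i%:R) *+ i.+1) *: u i.
Proof.
elim: i => [|i IH].
  by rewrite /= mulmxA rep_ef mulmxDl -mulmxA Ev mulmx0 add0r subr0 mulr1n.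
rewrite iterS mulmxA rep_ef mulmxDl -mulmxA IH act_f_string -scalemxAr.
rewrite -iterS -scalerDl; congr (_ *: _); ring.
Qed.

(** Applying e to f^(l+1) v = 0 gives (l + 1) (lam - l) f^l v = 0. *)
Lemma highest_weight_val : lam = l%:R.
Proof.
have := act_e_string l; rewrite ulS mulmx0 => /esym/eqP.
by rewrite scaler_eq0 (negbTE ul) orbF mulrn_eq0 /= subr_eq0 => /eqP.
Qed.

Lemma string_eq0 i : (l < i)%N -> u i = 0.
Proof.
move=> li; rewrite -(subnK li) iterD ulS.
by elim: (_ - _)%N => //= k ->; rewrite mulmx0.
Qed.

(** The rescaling of f^i v that turns the coefficients of e and f into those of
    the normalised model; it is forced by [string_coefS]. *)
Definition string_coef i : C := \prod_(j < i) (spin_coef C p j)^-1.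

Lemma string_coefS i : (i < l)%N ->
  string_coef i.+1 * spin_coef C p i = string_coef i.
Proof.
move=> il; rewrite /string_coef big_ord_recr /= mulfVK //.
by rewrite sqrtC_eq0 pnatr_eq0 muln_eq0 /= subn_eq0 -ltnNge.
Qed.

Lemma string_coef_neq0 i : (i < p)%N -> string_coef i != 0.
Proof.
move=> ip; apply/prodf_neq0 => j _; rewrite invr_neq0 //.
rewrite sqrtC_eq0 pnatr_eq0 muln_eq0 /= subn_eq0 -ltnNge.
exact: leq_trans (ltn_ord j) _.
Qed.

Definition string_mx : 'M[C]_(rdim W, p) :=
  \matrix_(r, i) (string_coef i *: u i) r 0.

Lemma mul_string_mx m (M : 'M_(m, rdim W)) r i :
  (M *m string_mx) r i = (string_coef i *: (M *m u i)) r 0.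
Proof. by rewrite scalemxAr !mxE; apply: eq_bigr => k _; rewrite !mxE. Qed.

Lemma string_hom : hom (spin_rep C p) W string_mx.
Proof.
apply: hom_ef; rewrite ?spin_rep_e ?spin_rep_f; apply/matrixP=> r i.
  rewrite mul_string_mx mxE.
  under eq_bigr do rewrite !mxE mulrnAr.
  case: (nat_of_ord i) (ltn_ord i) => [|k] kp.
    by rewrite Ev scaler0 mxE big1 // => j _; rewrite mulr0n.
  under eq_bigr do rewrite eqSS eq_sym -mulrA.
  rewrite (sum_ord_eq p k (fun j => string_coef j * (u j r 0 * spin_coef C p j))).
  rewrite (ltnW kp) act_e_string highest_weight_val scalerA mxE.
  rewrite -natrB; last by rewrite ltnW.
  have -> : (l - k)%:R *+ k.+1 = spin_coef C p k ^+ 2.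
    by rewrite spin_coef_sqr mulnC natrM mulr_natr.
  by rewrite -(string_coefS kp); ring.
rewrite mul_string_mx mxE.
under eq_bigr do rewrite !mxE mulrnAr.
rewrite (sum_ord_eq p i.+1
  (fun j => string_coef j * u j r 0 * spin_coef C p i)).
case: ltnP => il; first by rewrite -(string_coefS il) [RHS]mxE -iterS; ring.
by rewrite -iterS string_eq0 // scaler0 mxE.
Qed.

(** In a vanishing combination of the f^i v, the smallest index i with a
    nonzero coefficient would survive the application of f^(l-i), which kills all
    later terms and sends f^i v to f^l v, a nonzero vector. *)
Lemma string_inj : row_full string_mx.
Proof.
apply: row_fullP_ker => c.
have iterE k : iter k (mulmx X) (string_mx *m c) =
    \sum_(i < p) (c i 0 * string_coef i) *: u (k + i).
  elim: k => [|k IH] /=.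
    apply/matrixP=> r j; rewrite (ord1 j) summxE mxE.
    by apply: eq_bigr => i _; rewrite !mxE mulrC mulrA.
  rewrite IH mulmx_sumr; apply: eq_bigr => i _.
  by rewrite -scalemxAr.
move=> c0; apply/matrixP=> i j; rewrite (ord1 j) mxE {j}.
have iter0 k : iter k (mulmx X) (0 : 'cV_(rdim W)) = 0.
  by elim: k => //= k ->; rewrite mulmx0.
case: i => i ip; elim/ltn_ind: i ip => i IH ip.
have := iterE (l - i)%N; rewrite c0 iter0 (bigD1 (Ordinal ip)) //= big1.
  rewrite addr0 subnK -1?ltnS // => /esym/eqP.
  rewrite scaler_eq0 (negbTE ul) orbF mulf_eq0.
  by rewrite (negbTE (string_coef_neq0 ip)) orbF => /eqP.
case=> k kp; rewrite -val_eqE /= neq_ltn => /orP[ki|ik].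
  by rewrite IH // mul0r scale0r.
by rewrite string_eq0 ?scaler0 //; lia.
Qed.

End Cyclic.

(** Start from an eigenvector of h: its last nonzero image under the powers of
    e is a highest weight vector. As phi acts on columns from the left,
    [row_full phi] says that this action is injective. *)
Theorem exists_spin_sub (W : sl2_rep C) : (0 < rdim W)%N ->
  exists p (phi : 'M_(rdim W, p.+1)),
    hom (spin_rep C p.+1) W phi /\ row_full phi.
Proof.
move=> /(col_eigenvector (W (sl2_h C))) [a [w [w0 Hw]]].
have he : W (sl2_h C) *m W (sl2_e C) =
    W (sl2_e C) *m W (sl2_h C) + 2 *: W (sl2_e C).
  by rewrite scaler_nat rep_he.
have hf : W (sl2_h C) *m W (sl2_f C) =
    W (sl2_f C) *m W (sl2_h C) + (-2) *: W (sl2_f C).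
  by rewrite scaleNr scaler_nat rep_hf.
have two0 : 2 != 0 :> C by rewrite pnatr_eq0.
have two0N : - 2 != 0 :> C by rewrite oppr_eq0.
have [i [v0 Ev]] := last_nonzero_iter he two0 w0 Hw.
have Hv := iter_shift_eigen he i Hw.
have [l [ul ulS]] := last_nonzero_iter hf two0N v0 Hv.
exists l, (string_mx (iter i (mulmx (W (sl2_e C))) w) l).
by split; [apply: string_hom Hv ul ulS | apply: string_inj ul ulS].
Qed.

End HighestWeight.

(** * Complete reducibility by the unitary trick *)

Section CompleteReducibility.
Variable C : numClosedFieldType.
Implicit Types U W : sl2_rep C.

Definition adj m n (A : 'M[C]_(m, n)) : 'M[C]_(n, m) := map_mx Num.conj A^T.

Lemma adjM m n p (A : 'M[C]_(m, n)) (B : 'M_(n, p)) :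
  adj (A *m B) = adj B *m adj A.
Proof. by rewrite /adj trmx_mul map_mxM. Qed.

Lemma adjK m n (A : 'M[C]_(m, n)) : adj (adj A) = A.
Proof. by apply/matrixP=> i j; rewrite !mxE conjCK. Qed.

Lemma adj_mul_eq0 m (v : 'cV[C]_m) : adj v *m v = 0 -> v = 0.
Proof.
move=> /matrixP/(_ 0 0); rewrite !mxE => /eqP.
under eq_bigr do rewrite !mxE mulrC -normCK.
rewrite psumr_eq0 => [/allP vi|i _]; last exact: exprn_ge0.
apply/matrixP=> i j; rewrite (ord1 j) mxE; apply/eqP.
by have := vi i (mem_index_enum i); rewrite expf_eq0 /= normr_eq0.
Qed.

(** Invariance of the standard Hermitian form under the compact real form of
    sl_2; the condition on h follows. *)
Definition unitary_rep W := adj (W (sl2_e C)) = W (sl2_f C).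

Lemma unitary_spin p : unitary_rep (spin_rep C p).
Proof.
rewrite /unitary_rep spin_rep_e spin_rep_f; apply/matrixP=> i j.
rewrite !mxE rmorphMn /=; congr (_ *+ _); apply/CrealP.
by rewrite realE sqrtC_ge0 ler0n.
Qed.

Lemma unitary_trivial : unitary_rep (trivial_rep C).
Proof. by apply/matrixP=> i j; rewrite !mxE rmorph0. Qed.

Lemma unitary_tens U W :
  unitary_rep U -> unitary_rep W -> unitary_rep (tens_rep U W).
Proof.
rewrite /unitary_rep => Uu Wu; rewrite /= /tens_act -Uu -Wu.
apply/matrixP=> i j; rewrite !mxE rmorphD !rmorphM !rmorph_nat.
by rewrite [_ == (mxtens_unindex i).1]eq_sym [_ == (mxtens_unindex i).2]eq_sym.
Qed.

Lemma unitary_tpow U n : unitary_rep U -> unitary_rep (tpow_rep U n).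
Proof.
by move=> Uu; elim: n => [|n IH]; [apply: unitary_trivial | apply: unitary_tens].
Qed.

(** Taking conjugate transposes turns the intertwiner phi into an intertwiner
    phi^* in the opposite direction, and phi^* phi is invertible because it is
    positive definite. *)
Lemma unitary_retraction U W (phi : 'M_(rdim W, rdim U)) :
  unitary_rep U -> unitary_rep W -> hom U W phi -> row_full phi ->
  exists r, hom W U r /\ r *m phi = 1%:M.
Proof.
move=> Uu Wu hphi /mulVpmx phiK.
have hadj : hom W U (adj phi).
  apply: hom_ef.
    by rewrite -[U _]adjK -[W _]adjK Uu Wu -!adjM hphi.
  by rewrite -Uu -Wu -!adjM hphi.
pose G := adj phi *m phi; have hG : hom U U G by exact: hom_comp hadj hphi.
have uG : G \in unitmx.
  rewrite -row_full_unit; apply: row_fullP_ker => v Gv.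
  rewrite -[v]mul1mx -phiK -mulmxA [phi *m v](@adj_mul_eq0) ?mulmx0 //.
  by rewrite adjM -mulmxA (mulmxA (adj phi)) Gv mulmx0.
exists (invmx G *m adj phi); split; last by rewrite -mulmxA mulVmx.
apply: hom_comp hadj; apply: hom_inv hG _ _; first exact: mulmxV.
exact: mulVmx.
Qed.

(** The form of complete reducibility used in the induction on the dimension:
    unlike unitarity in a fixed basis, it passes to direct summands without a
    choice of orthonormal bases ([splits_sub]). *)
Definition splits_spins W := forall p (phi : 'M_(rdim W, p)),
  hom (spin_rep C p) W phi -> row_full phi ->
  exists r, hom W (spin_rep C p) r /\ r *m phi = 1%:M.

Lemma unitary_splits W : unitary_rep W -> splits_spins W.
Proof.
by move=> Wu p phi; apply: unitary_retraction => //; apply: unitary_spin.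
Qed.

Lemma splits_sub W U B (B' : 'M_(rdim U, rdim W)) :
  splits_spins W -> hom U W B -> B' *m B = 1%:M -> splits_spins U.
Proof.
move=> splW hB BK p phi hphi fphi.
have [|r [hr rphi]] := splW p _ (hom_comp hB hphi).
  apply: row_fullP_ker => v; rewrite -mulmxA => /(congr1 (mulmx B')).
  rewrite !mulmxA BK mul1mx mulmx0 => /(congr1 (mulmx (pinvmx phi))).
  by rewrite mulmxA mulVpmx // mul1mx mulmx0.
by exists (r *m B); split; [exact: hom_comp hr hB | rewrite -mulmxA].
Qed.

(** The image of an intertwining idempotent B B', as a representation on the
    coordinates given by a factorisation with B' B = 1. *)
Section Summand.
Variables (W : sl2_rep C) (m : nat).
Variables (B : 'M[C]_(rdim W, m)) (B' : 'M[C]_(m, rdim W)).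
Hypotheses (BK : B' *m B = 1%:M) (hP : hom W W (B *m B')).

Definition summand_act (x : sl2 C) : 'M[C]_m := B' *m W x *m B.

Fact summand_act_linear : linear summand_act.
Proof.
move=> a x y; rewrite /summand_act linearP mulmxDr mulmxDl.
by rewrite -scalemxAr -scalemxAl.
Qed.

HB.instance Definition _ :=
  GRing.isLinear.Build C (sl2 C) 'M[C]_m *:%R summand_act summand_act_linear.

Fact summand_incl x : W x *m B = B *m summand_act x.
Proof.
rewrite /summand_act !mulmxA hP -!mulmxA; congr (_ *m _).
by rewrite BK mulmx1.
Qed.

Fact summand_act_bracket (x y : sl2 C) :
  summand_act (bracket x y) =
  summand_act x *m summand_act y - summand_act y *m summand_act x.
Proof.
have act2 z t : B' *m (W z *m W t) *m B = summand_act z *m summand_act t.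
  by rewrite -!mulmxA summand_incl !mulmxA.
by rewrite -!act2 {1}/summand_act ract_bracket mulmxBr mulmxBl.
Qed.

Definition summand_rep : sl2_rep C := Sl2Rep summand_act_bracket.

Lemma summand_incl_hom : hom summand_rep W B.
Proof. by move=> x; rewrite summand_incl. Qed.

End Summand.

(** The complement is the image of the idempotent 1 - phi r, and the
    factorisation of this idempotent is its rank decomposition. *)
Lemma split_off U W phi r : hom U W phi -> hom W U r -> r *m phi = 1%:M ->
  exists (W' : sl2_rep C) B (B' : 'M_(rdim W', rdim W)),
    [/\ hom W' W B, B' *m B = 1%:M & W ~= U (+) W'].
Proof.
move=> hphi hr rK; pose P := 1%:M - phi *m r.
have hphir : hom W W (phi *m r) by exact: hom_comp hr.
have hP : hom W W P by move=> x; rewrite mulmxBr mulmxBl mulmx1 mul1mx hphir.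
have PP : P *m P = P.
  rewrite {2}/P mulmxBr mulmx1 {2}/P mulmxBl mul1mx !mulmxA -(mulmxA phi) rK.
  by rewrite mulmx1 subrr subr0.
have rP : r *m P = 0 by rewrite mulmxBr mulmxA rK mulmx1 mul1mx subrr.
have Pphi : P *m phi = 0 by rewrite mulmxBl -mulmxA rK mulmx1 mul1mx subrr.
have [m [B [B' [L [R [BB' BL B'R]]]]]] : exists m (B : 'M_(_, m)) (B' : 'M_(m, _))
    L R, [/\ B *m B' = P, L *m B = 1%:M & B' *m R = 1%:M].
  exists _, (col_base P), (row_base P), (pinvmx (col_base P)),
    (pinvmx (row_base P)); split; first exact: mulmx_base.
    by apply/mulVpmx/col_base_full.
  by apply/mulmxVp/row_base_free.
have BK : B' *m B = 1%:M.
  rewrite -[LHS]mul1mx -BL -[LHS]mulmx1 -B'R.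
  (* B is left cancellable and B' right cancellable, so that B' B = 1 follows
     from the idempotence of B B'. *)
  have -> : L *m B *m (B' *m B) *m (B' *m R) =
      L *m ((B *m B') *m (B *m B')) *m R by rewrite !mulmxA.
  by rewrite BB' PP -BB' !mulmxA BL mul1mx B'R.
rewrite -BB' in hP.
exists (summand_rep BK hP), B, B'; split=> //; first exact: summand_incl_hom.
have PB : P *m B = B by rewrite -BB' -mulmxA BK mulmx1.
have B'P : B' *m P = B' by rewrite -BB' mulmxA BK mul1mx.
exists (col_mx r B'), (row_mx phi B); split.
- move=> x; rewrite mul_col_mx mul_block_col !mul0mx addr0 add0r hr /= /summand_act.
  by congr col_mx; rewrite -!mulmxA -hP !mulmxA BK mul1mx.
- rewrite mul_col_row rK BK -[X in r *m X]PB -[X in X *m phi]B'P.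
  by rewrite mulmxA rP mul0mx -mulmxA Pphi mulmx0 -scalar_mx_block.
by rewrite mul_row_col BB' addrC subrK.
Qed.

Theorem splits_list_rep W : splits_spins W ->
  exists s, all (ltn 0) s /\ W ~= list_rep (spin_rep C) s.
Proof.
have [n] := ubnP (rdim W); elim: n W => // n IH W; rewrite ltnS => Wn splW.
have [W0|W0] := posnP (rdim W).
  by exists [::]; split=> //; rewrite /list_rep big_nil; apply: isom_dim0.
have [p [phi [hphi fphi]]] := exists_spin_sub W0.
have [r [hr rphi]] := splW _ _ hphi fphi.
have [W' [B [B' [hB BK WW']]]] := split_off hphi hr rphi.
have [|s [s0 W's]] := IH W' _ (splits_sub splW hB BK).
  by apply: leq_trans Wn; rewrite (isom_rdim WW') /= addSn ltnS leq_addl.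
exists (p.+1 :: s); split=> //; rewrite /list_rep big_cons.
exact: isom_trans WW' (dsum_isom (isom_refl _) W's).
Qed.

End CompleteReducibility.

(** * Weight multiplicities *)

Section Weights.
Variable C : numClosedFieldType.
Implicit Types U W : sl2_rep C.

(** The action of h has to be diagonal in the given coordinates, as it is in
    the models and in their tensor products; mu a is the multiplicity of the
    weight a. *)
Definition has_weights W (mu : int -> nat) :=
  exists w : 'I_(rdim W) -> int,
    W (sl2_h C) = diag_mx (\row_i (w i)%:~R) /\
    forall a, (\sum_i (w i == a) = mu a)%N.

(** The entry f i j of an isomorphism vanishes unless the weights u j and w i
    agree. Hence the partial traces of g f and of f g over the weight a are the
    same sum, and they count the coordinates of weight a on either side. *)
Lemma isom_weights U W mu nu :
  U ~= W -> has_weights U mu -> has_weights W nu -> mu =1 nu.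
Proof.
move=> [f [g [hf fg gf]]] [u [Uu muE]] [w [Ww nuE]] a.
have fw i j : f i j != 0 -> u j = w i.
  have /matrixP/(_ i j) := hf (sl2_h C).
  rewrite Uu Ww mul_mx_diag mul_diag_mx !mxE mulrC => fE f0.
  by apply: (@intr_inj C); apply: (mulIf f0).
apply/eqP; rewrite -muE -nuE -(eqr_nat C) !natr_sum; apply/eqP.
transitivity (\sum_j \sum_i (u j == a)%:R * (g j i * f i j)).
  apply: eq_bigr => j _; rewrite -mulr_sumr.
  by have /matrixP/(_ j j) := gf; rewrite !mxE eqxx => ->; rewrite mulr1.
rewrite exchange_big; apply: eq_bigr => i _ /=.
have /matrixP/(_ i i) := fg; rewrite !mxE eqxx => fgi.
rewrite -[RHS]mulr1 -[1]fgi mulr_sumr; apply: eq_bigr => j _.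
have [->|/fw ->] := eqVneq (f i j) 0; first by rewrite mulr0 mul0r !mulr0.
by rewrite [g j i * _]mulrC.
Qed.

Lemma weights_zero : has_weights (zero_rep C) (fun=> 0%N).
Proof.
exists (fun=> 0); split; first by apply/matrixP=> -[].
by move=> a; rewrite big_ord0.
Qed.

Lemma weights_trivial : has_weights (trivial_rep C) (fun a => (a == 0) : nat).
Proof.
exists (fun=> 0); split; last by move=> a; rewrite big_ord1 eq_sym.
by apply/matrixP=> i j; rewrite /= /null_act !mxE mul0rn.
Qed.

Lemma weights_spin p :
  has_weights (spin_rep C p) (fun a => \sum_(i < p) (spin_wt p i == a))%N.
Proof. by exists (fun i => spin_wt p i); rewrite spin_rep_h. Qed.

Lemma weights_dsum U W mu nu : has_weights U mu -> has_weights W nu ->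
  has_weights (U (+) W) (fun a => mu a + nu a)%N.
Proof.
move=> [u [Uu muE]] [w [Ww nuE]].
exists (fun k => match split k with inl i => u i | inr j => w j end); split.
  rewrite /= /dsum_act Uu Ww; apply/matrixP=> i j; rewrite !mxE.
  case: (splitP i) => i' ei; rewrite mxE; case: splitP => j' ej; rewrite !mxE.
  - by congr (_ *+ _); rewrite -!val_eqE /= ei ej.
  - by rewrite -val_eqE /= ei ej ltn_eqF ?mulr0n // (leq_trans (ltn_ord i')) ?leq_addr.
  - by rewrite -val_eqE /= ei ej gtn_eqF ?mulr0n // (leq_trans (ltn_ord j')) ?leq_addr.
  - by congr (_ *+ _); rewrite -!val_eqE /= ei ej eqn_add2l.
move=> a; rewrite big_split_ord /= -muE -nuE; congr addn.
  by apply: eq_bigr => i _; rewrite (unsplitK (inl i)).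
by apply: eq_bigr => i _; rewrite (unsplitK (inr i)).
Qed.

Lemma weights_list mu V s : (forall k, has_weights (V k) (mu k)) ->
  has_weights (list_rep V s) (fun a => \sum_(k <- s) mu k a)%N.
Proof.
move=> Vmu; elim: s => [|k s [w [Ww wE]]]; rewrite /list_rep.
  have [w [Ww wE]] := weights_zero; rewrite big_nil.
  by exists w; split=> // a; rewrite big_nil wE.
have IH : has_weights (list_rep V s) (fun a => \sum_(k <- s) mu k a)%N.
  by exists w.
have [v [Vv vE]] := weights_dsum (Vmu k) IH.
by rewrite big_cons; exists v; split=> // a; rewrite big_cons vE.
Qed.

Lemma weights_tens_spin d W nu : has_weights W nu ->
  has_weights (tens_rep (spin_rep C d) W)
    (fun a => \sum_(i < d) nu (a - spin_wt d i)%R)%N.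
Proof.
move=> [w [Ww nuE]].
exists (fun k => spin_wt d (mxtens_unindex k).1 + w (mxtens_unindex k).2); split.
  apply/matrixP=> k l; case: (mxtens_indexP k) => i j.
  case: (mxtens_indexP l) => i' j'.
  rewrite /tens_rep [LHS]/= /tens_act spin_rep_h Ww mxE !tensmxE !mxE.
  rewrite !mxtens_indexK /= (can_eq (@mxtens_indexK _ _)) xpair_eqE intrD.
  by case: (i == i'); case: (j == j'); rewrite /= ?mulr1n ?mulr0n; ring.
move=> a; under [RHS]eq_bigr do rewrite -nuE.
rewrite pair_big (reindex (@mxtens_index d (rdim W))); last first.
  exists (@mxtens_unindex _ _) => k _; first exact: mxtens_indexK.
  exact: mxtens_unindexK.
apply: eq_bigr => -[i j] _; rewrite mxtens_indexK /=; congr (nat_of_bool _).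
by rewrite [RHS]eq_sym subr_eq eq_sym addrC.
Qed.

End Weights.

(** * The Catalan triangle counts the summands of a tensor power *)

(** The coefficient of q^a in (q^(1-d) + q^(3-d) + ... + q^(d-1))^n. *)
Fixpoint tpow_mult (d n : nat) (a : int) : nat :=
  if n is n'.+1 then (\sum_(i < d) tpow_mult d n' (a - spin_wt d i)%R)%N
  else a == 0.

Lemma weights_tpow_spin (C : numClosedFieldType) d n :
  has_weights (tpow_rep (spin_rep C d) n) (tpow_mult d n).
Proof.
by elim: n => [|n IH]; [apply: weights_trivial | apply: weights_tens_spin].
Qed.

(** Both sides satisfy the same recurrence in n, as the step k -> k +- 1
    commutes with the shifts in it. *)
Lemma catalan_triangleE d n k :
  catalan_triangle d k n
  = (tpow_mult d n (k - 1))%:Z - (tpow_mult d n (k + 1))%:Z.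
Proof.
elim: n k => [|n IH] k /=.
  by rewrite subr_eq0 addr_eq0; case: eqP => [->|_] //; case: eqP.
rewrite !(big_morph Posz PoszD (erefl (Posz 0))) -sumrB; apply: eq_bigr => j _; rewrite IH /spin_wt.
by congr (Posz (tpow_mult _ _ _) - Posz (tpow_mult _ _ _)); ring.
Qed.

(** The weights k - 1, k - 3, ..., 1 - k lie in steps of 2, so the difference
    telescopes: its first term is [k == j], and its last one vanishes because
    - k - 1 is never j - 1. *)
Lemma spin_mult_diff k j : (0 < k)%N -> (0 < j)%N ->
  \sum_(i < k) (spin_wt k i == j%:Z - 1)%:Z
  - \sum_(i < k) (spin_wt k i == j%:Z + 1)%:Z = (k == j)%:Z.
Proof.
move=> k0 j0; rewrite -sumrB.
pose g i : int := (spin_wt k i == j%:Z - 1).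
have -> : \sum_(i < k) ((spin_wt k i == j%:Z - 1)%:Z
    - (spin_wt k i == j%:Z + 1)%:Z) = \sum_(0 <= i < k) - (g i.+1 - g i).
  rewrite big_mkord; apply: eq_bigr => i _; rewrite opprB /g.
  by congr (_ - Posz (nat_of_bool _)); rewrite (spin_wtS k i); lia.
rewrite sumrN telescope_sumr // opprB.
have -> : g k = 0 by rewrite /g /spin_wt; case: eqP => //; lia.
by rewrite subr0 /g /spin_wt; congr (Posz (nat_of_bool _)); lia.
Qed.

(** The list s exists by complete reducibility; comparing the weights of both
    sides at k - 1 and k + 1 determines how often k occurs in it. *)
Theorem tpow_spin_decomposition (C : numClosedFieldType) d n : exists s,
  [/\ all (ltn 0) s, tpow_rep (spin_rep C d) n ~= list_rep (spin_rep C) s &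
      forall k, (0 < k)%N -> catalan_triangle d k n = (count_mem k s)%:Z].
Proof.
have [s [s0 iso]] := splits_list_rep
  (unitary_splits (unitary_tpow n (unitary_spin C d))).
exists s; split=> // k k0.
have mE := isom_weights iso (weights_tpow_spin C d n)
  (weights_list s (@weights_spin C)).
rewrite catalan_triangleE !mE {iso mE}.
elim: s s0 => [|j s IH] /=; first by rewrite !big_nil.
move=> /andP[j0 /IH {}IH]; rewrite !big_cons !PoszD opprD addrACA IH.
by rewrite !(big_morph Posz PoszD (erefl (Posz 0))) spin_mult_diff.
Qed.


(** * Arbitrary irreducible representations *)

Section Irreducible.
Variable C : numClosedFieldType.
Implicit Types V W : sl2_rep C.

Lemma ker_invariant V W f : hom V W f ->
  forall x v, v \in lker (linfun (mulmx f)) ->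
  V x *m v \in lker (linfun (mulmx f : 'cV_(rdim V) -> 'cV_(rdim W))).
Proof.
move=> hf x v; rewrite !memv_ker !lfunE /= => /eqP fv.
by rewrite mulmxA hf -mulmxA fv mulmx0.
Qed.

Lemma img_invariant V W f : hom V W f ->
  forall x w, w \in limg (linfun (mulmx f)) ->
  W x *m w \in limg (linfun (mulmx f : 'cV_(rdim V) -> 'cV_(rdim W))).
Proof.
move=> hf x w /memv_imgP[v _ ->]; rewrite lfunE /= mulmxA -hf -mulmxA.
apply/memv_imgP; exists (V x *m v); first exact: memvf.
by rewrite lfunE.
Qed.

Lemma mulmx_cV0 m n (A : 'M[C]_(m, n)) :
  (forall v : 'cV_n, A *m v = 0) -> A = 0.
Proof.
move=> A0; apply/matrixP=> i j.
by have /matrixP/(_ i 0) := A0 (delta_mx j 0); rewrite -colE !mxE.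
Qed.

(** By irreducibility a nonzero intertwiner has zero kernel and full image, so
    it would force the dimensions to agree. *)
Lemma schur_dim V W f : irreducible_rep V -> irreducible_rep W ->
  hom V W f -> rdim V != rdim W -> f = 0.
Proof.
move=> [_ irrV] [_ irrW] hf neq.
pose phi := linfun (mulmx f : 'cV_(rdim V) -> 'cV_(rdim W)).
apply: mulmx_cV0 => v.
have -> : f *m v = phi v by rewrite lfunE.
have [ker0|kerT] := irrV _ (ker_invariant hf); last first.
  by apply/eqP; rewrite -memv_ker kerT memvf.
have [img0|imgT] := irrW _ (img_invariant hf).
  by apply/eqP; rewrite -memv0 -img0 memv_img ?memvf.
have := limg_ker_dim phi fullv; rewrite ker0 capv0 dimv0 add0n imgT !dimvf.
by rewrite /dim /= !muln1 => /esym/eqP; rewrite (negbTE neq).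
Qed.

(** The copy of a model inside V is an invariant subspace, hence all of V. *)
Lemma irreducible_isom_spin V : irreducible_rep V ->
  spin_rep C (rdim V) ~= V.
Proof.
move=> [V0 irrV]; have [p [phi [hphi fphi]]] := exists_spin_sub V0.
have phiL := mulVpmx fphi.
pose psi := linfun (mulmx phi : 'cV_p.+1 -> 'cV_(rdim V)).
have psi_inj : lker psi == 0%VS.
  apply/eqP/vspaceP=> v; rewrite memv_ker memv0 lfunE /=.
  apply/eqP/eqP=> [pv|->]; last by rewrite mulmx0.
  by rewrite -[v]mul1mx -phiL -mulmxA pv mulmx0.
have dimV : p.+1 = rdim V.
  have dim_img : \dim (limg psi) = p.+1.
    by rewrite limg_dim_eq ?(eqP psi_inj) ?capv0 // dimvf /dim /= muln1.
  have [img0|imgT] := irrV _ (img_invariant hphi).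
    by have := dim_img; rewrite -[limg psi]/(limg _) img0 dimv0.
  by have := dim_img; rewrite imgT dimvf /dim /= muln1.
rewrite -dimV; exists phi, (pinvmx phi); split=> //.
by apply: mulmxVp; rewrite /row_free (eqP fphi) dimV.
Qed.

(** Every component of such an intertwiner vanishes by Schur's lemma. *)
Lemma hom_list_rep0 (V : nat -> sl2_rep C) U s :
  irreducible_rep U ->
  {in s, forall j, irreducible_rep (V j) /\ rdim U != rdim (V j)} ->
  forall f, hom U (list_rep V s) f -> f = 0.
Proof.
move=> irrU; rewrite /list_rep; elim: s => [|j s IH] irrV.
  by rewrite big_nil => f _; apply/matrixP=> -[].
rewrite big_cons => f; rewrite -[f]vsubmxK => hf.
have [hu hd] : hom U (V j) (usubmx f) /\
    hom U (\big[@dsum_rep C/zero_rep C]_(j <- s) V j) (dsubmx f).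
  split=> x; have := hf x; rewrite mul_col_mx mul_block_col !mul0mx addr0 add0r;
  by case/eq_col_mx.
have [irrj neq] := irrV j (mem_head _ _).
rewrite (schur_dim irrU irrj hu neq) (IH _ _ hd) ?col_mx0 // => i si.
by apply: irrV; rewrite inE si orbT.
Qed.

End Irreducible.

(** * The decomposition of tensor powers *)

Theorem corollary3p4 (R : realType)
  (V : nat -> sl2_rep R[i])
  (irrV : forall k : nat, (0 < k)%N -> irreducible_rep (V k) /\ rdim (V k) = k)
  (d : nat) (d_ge2 : (2 <= d)%N) (n : nat) :
  [/\ forall k : nat, (0 < k)%N -> 0 <= catalan_triangle d k n,
      exists N : nat,
        (forall k : nat, (N < k)%N -> catalan_triangle d k n = 0) /\
        isom_rep (tpow_rep (V d) n)
          (\big[@dsum_rep R[i]/zero_rep R[i]]_(1 <= k < N.+1)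
             copies_rep `|catalan_triangle d k n|%N (V k))
    & forall k : nat, (0 < k)%N ->
        has_multiplicity (V k) (tpow_rep (V d) n) `|catalan_triangle d k n|%N].
Proof.
have spinV k : (0 < k)%N -> V k ~= spin_rep R[i] k.
  move=> k0; have [irrk dimk] := irrV k k0.
  by apply: isom_sym; have := irreducible_isom_spin irrk; rewrite dimk.
have [s [/allP s0 spin_s cE]] := tpow_spin_decomposition R[i] d n.
have Vs : tpow_rep (V d) n ~= list_rep V s.
  have VdS : tpow_rep (V d) n ~= tpow_rep (spin_rep R[i] d) n.
    elim: (n) => [|m IH]; first exact: isom_refl.
    exact: tens_isom (spinV d (ltnW d_ge2)) IH.
  apply: isom_trans VdS (isom_trans spin_s _).
  by apply: list_rep_isom => k /s0 k0; apply/isom_sym/spinV.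
split=> [k k0||k k0]; first by rewrite cE.
  exists (\max_(k <- s) k); split=> [k sk|].
    have k0 : (0 < k)%N by apply: leq_trans sk.
    rewrite cE //; congr Posz; apply/count_memPn; apply: contraTN sk => ks.
    by rewrite -leqNgt leq_bigmax_seq.
  apply: isom_trans Vs _.
  rewrite (eq_big_nat _ _ (F2 := fun k => copies_rep (count_mem k s) (V k))).
    apply: list_rep_group => k sk; apply/andP; split; first exact: s0.
    exact: leq_bigmax_seq.
  by move=> k /andP[k0 _]; rewrite cE.
exists (list_rep V [seq j <- s | j != k]); split.
  by rewrite cE //; apply: isom_trans Vs (list_rep_split _ _ _).
move=> [f [hf injf]]; have [irrk dimk] := irrV k k0.
have f0 : f = 0.
  apply: hom_list_rep0 irrk _ _ hf => j; rewrite mem_filter => /andP[jk /s0 j0].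
  by have [irrj ->] := irrV j j0; rewrite dimk eq_sym.
have /matrixP : const_mx 1 = 0 :> 'cV[R[i]]_(rdim (V k)).
  by apply: injf; rewrite /= f0 !mul0mx.
case: (irrk) => dk _ /(_ (Ordinal dk) 0); rewrite !mxE => /eqP.
by rewrite oner_eq0.
Qed.
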